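(* (Representation Formula) Let $f\in{}_{RL}\mathcal{SM}^{(\alpha,\beta)}_{(g,h)}(\mathcal S_{a,b,c})$. Then for every $x=u+\mathcal I_x v\in\mathcal S_{a,b,c}$ (with $u\in[a,b]$, $v\in[0,c]$, $\mathcal I_x\in\mathbb S$) and every $\mathcal I\in\mathbb S$, $$\frac1{g'(u)}[\mathbf I_{a^+}^{1-\alpha,g}f|_{\mathcal S_{a,b,c,\mathcal I_x}}](u+\mathcal I_x s)+\frac1{h'(v)}[\mathbf I_{0^+}^{1-\beta,h}f|_{\mathcal S_{a,b,c,\mathcal I_x}}](r+\mathcal I_x v)$$ $$=\frac1{2g'(u)}\left\{\mathbf I_{a^+}^{1-\alpha,g}\left[f_{\mathcal I}^{s}-\mathcal I_x\mathcal I f_{\mathcal I}^{s}\right](u)+\mathbf I_{a^+}^{1-\alpha,g}\left[f_{-\mathcal I}^{s}+\mathcal I_x\mathcal I f_{-\mathcal I}^{s}\right](u)\right\}$$ $$\quad+\frac1{2h'(v)}\left\{\mathbf I_{0^+}^{1-\beta,h}\left[f_{\mathcal I,r}-\mathcal I_x\mathcal I f_{\mathcal I,r}\right](v)+\mathbf I_{0^+}^{1-\beta,h}\left[f_{-\mathcal I,r}+\mathcal I_x\mathcal I f_{-\mathcal I,r}\right](v)\right\},$$ where, for $\mathcal J\in\mathbb S$, $f_{\mathcal J}^{s}(\tau)=f(\tau+\mathcal J s)$ for $\tau\in[a,b]$ and $f_{\mathcal J,r}(\tau)=f(r+\mathcal J\tau)$ for $\tau\in[0,c]$.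
   Context: $\mathbb R_n$ is the real Clifford algebra generated by $e_1,\dots,e_n$ with $e_ie_j+e_je_i=-2\delta_{ij}$; $\mathbb R^{n+1}$ is identified with the paravectors $x_0+\sum_j x_je_j$; $\mathbb S=\{\sum_j x_je_j:\sum_j x_j^2=1\}$. Let $a<b$, $c>0$ be real, $\alpha,\beta\in(0,1)$, and fix $r\in[a,b]$, $s\in[0,c]$. $\mathcal S_{a,b,c}=\{u+\mathcal I v\in\mathbb R^{n+1} : u\in[a,b],\ v\in[0,c],\ \mathcal I\in\mathbb S\}$, and $\mathcal S_{a,b,c,\mathcal I}=\{u+\mathcal I v : u\in[a,b],\ v\in[0,c]\}$. $AC^1(\mathcal S_{a,b,c},\mathbb R_n)$ is the set of continuous $f:\mathcal S_{a,b,c}\to\mathbb R_n$ such that for every $\mathcal I\in\mathbb S$ the maps $u\mapsto f(u+\mathcal I s)$ on $[a,b]$ and $v\mapsto f(r+\mathcal I v)$ on $[0,c]$ are absolutely continuous. Let $\lambda\in\mathbb R$ and let $g\in C^2([a,b],\mathbb R)$, $h\in C^2([0,c],\mathbb R)$ be restrictions of $C^2(\mathbb R,\mathbb R)$ solutions of $y''+2\lambda y'=0$, with $g'>0$ on $[a,b]$ and $h'>0$ on $[0,c]$. For an integrable $\mathbb R_n$-valued $\varphi$ on $[a,b]$, respectively $\psi$ on $[0,c]$, $$\mathbf I_{a^+}^{1-\alpha,g}[\varphi](u)=\frac1{\Gamma(1-\alpha)}\int_a^u\frac{\varphi(\tau)}{(g(u)-g(\tau))^\alpha}g'(\tau)\,d\tau,\qquad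 \mathbf I_{0^+}^{1-\beta,h}[\psi](v)=\frac1{\Gamma(1-\beta)}\int_0^v\frac{\psi(\tau)}{(h(v)-h(\tau))^\beta}h'(\tau)\,d\tau,$$ with value $0$ at $u=a$, respectively $v=0$. For $\mathcal J\in\mathbb S$, $[\mathbf I_{a^+}^{1-\alpha,g}f|_{\mathcal S_{a,b,c,\mathcal J}}](u+\mathcal J s)$ is the first integral with $\varphi(\tau)=f(\tau+\mathcal J s)$, and $[\mathbf I_{0^+}^{1-\beta,h}f|_{\mathcal S_{a,b,c,\mathcal J}}](r+\mathcal J v)$ is the second with $\psi(\tau)=f(r+\mathcal J\tau)$. ${}_{RL}\mathcal{SM}^{(\alpha,\beta)}_{(g,h)}(\mathcal S_{a,b,c})$ is the set of $f\in AC^1(\mathcal S_{a,b,c},\mathbb R_n)$ such that, for all $\mathcal I\in\mathbb S$, the maps $u\mapsto[\mathbf I_{a^+}^{1-\alpha,g}f|_{\mathcal S_{a,b,c,\mathcal I}}](u+\mathcal I s)$, $u\in[a,b]$, and $v\mapsto[\mathbf I_{0^+}^{1-\beta,h}f|_{\mathcal S_{a,b,c,\mathcal I}}](r+\mathcal I v)$, $v\in[0,c]$, are of class $C^1$ and $$\frac1{g'(u)}\frac{\partial}{\partial u}[\mathbf I_{a^+}^{1-\alpha,g}f|_{\mathcal S_{a,b,c,\mathcal I}}](u+\mathcal I s)+\mathcal I\,\frac1{h'(v)}\frac{\partial}{\partial v}[\mathbf I_{0^+}^{1-\beta,h}f|_{\mathcal S_{a,b,c,\mathcal I}}](r+\mathcal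 I v)=0\qquad\forall\,u+\mathcal I v\in\mathcal S_{a,b,c,\mathcal I}.$$ *)

(* Defs.v *)
From HB Require Import structures.
From mathcomp Require Import all_boot all_order all_algebra.
From mathcomp Require Import all_classical all_reals all_analysis.
Set Implicit Arguments.
Unset Strict Implicit.
Unset Printing Implicit Defensive.
Import Order.TTheory GRing.Theory Num.Theory.
Import numFieldNormedType.Exports.
Local Open Scope classical_set_scope.
Local Open Scope ring_scope.

Section SymmetricDifference.
Variable n : nat.
Implicit Types A B C : {set 'I_n}.

Definition symdiff A B : {set 'I_n} := [set i | (i \in A) (+) (i \in B)]%SET.

(* Sorting the word e_A e_B uses one transposition for every pair
   i \in A, j \in B with j < i, and one relation e_i ^+ 2 = -1 for every
   common index; each of these contributes a factor -1. *)
Definition swaps A B : nat :=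
  #|[set p : 'I_n * 'I_n | [&& p.1 \in A, p.2 \in B & (p.2 <= p.1)%N]]%SET|.

Lemma symdiffC A B : symdiff A B = symdiff B A.
Proof. by apply/setP => i; rewrite !inE addbC. Qed.

Lemma symdiffA A B C : symdiff A (symdiff B C) = symdiff (symdiff A B) C.
Proof. by apply/setP => i; rewrite !inE addbA. Qed.

Lemma symdiff0 A : symdiff A finset.set0 = A.
Proof. by apply/setP => i; rewrite !inE addbF. Qed.

Lemma sym0diff A : symdiff finset.set0 A = A.
Proof. by rewrite symdiffC symdiff0. Qed.

Lemma symdiffv A : symdiff A A = finset.set0.
Proof. by apply/setP => i; rewrite !inE addbb. Qed.

Lemma symdiffK A : involutive (symdiff A).
Proof. by move=> B; rewrite symdiffA symdiffv sym0diff. Qed.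

Lemma symdiff_eq0 A B : (symdiff A B == finset.set0) = (A == B).
Proof.
apply/eqP/eqP => [AB0|->]; last exact: symdiffv.
by rewrite -(symdiffK A B) AB0 symdiff0.
Qed.

Lemma odd_swaps A B : odd (swaps A B) =
  \big[addb/false]_(p : 'I_n * 'I_n) [&& p.1 \in A, p.2 \in B & (p.2 <= p.1)%N].
Proof.
rewrite /swaps -sum1dep_card big_mkcond /= (big_morph odd oddD (erefl _)).
by apply: eq_bigr => p _; case: ifP.
Qed.

Lemma odd_swapsDl A B C :
  odd (swaps (symdiff A B) C) = odd (swaps A C) (+) odd (swaps B C).
Proof.
rewrite !odd_swaps -big_split /=; apply: eq_bigr => p _; rewrite !inE.
by case: (p.1 \in A); case: (p.1 \in B); case: (p.2 \in C); case: (_ <= _)%N.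
Qed.

Lemma odd_swapsDr A B C :
  odd (swaps A (symdiff B C)) = odd (swaps A B) (+) odd (swaps A C).
Proof.
rewrite !odd_swaps -big_split /=; apply: eq_bigr => p _; rewrite !inE.
by case: (p.1 \in A); case: (p.2 \in B); case: (p.2 \in C); case: (_ <= _)%N.
Qed.

Lemma swaps0l A : swaps finset.set0 A = 0%N.
Proof. by apply: eq_card0 => p; rewrite !inE. Qed.

Lemma swaps0r A : swaps A finset.set0 = 0%N.
Proof. by apply: eq_card0 => p; rewrite !inE andbF. Qed.

Lemma swaps1 (i j : 'I_n) :
  odd (swaps (finset.set1 i) (finset.set1 j)) = (j <= i)%N.
Proof.
rewrite odd_swaps (bigD1 (i, j)) //= !inE !eqxx /= big1 ?addbF // => -[k l].
by rewrite !inE xpair_eqE /=; case: eqP => //= _; case: eqP.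
Qed.

End SymmetricDifference.

(* An element is stored as the row of its coordinates on the blades
   e_A = e_(i1) * ... * e_(ik), A = {i1 < ... < ik}, so that it inherits the
   (finite dimensional, hence unique) vector topology of row vectors. *)
Definition clifford (R : realType) (n : nat) := 'rV[R]_#|{set 'I_n}|.

HB.instance Definition _ (R : realType) (n : nat) :=
  NormedModule.copy (clifford R n) 'rV[R]_#|{set 'I_n}|.

Section CliffordAlgebra.
Variables (R : realType) (n : nat).
Implicit Types (x y z : clifford R n) (A B C : {set 'I_n}).

Definition coef x A : R := (x : 'rV_ _) ord0 (enum_rank A).

Definition of_coef (F : {set 'I_n} -> R) : clifford R n :=
  \row_(k < #|{set 'I_n}|) F (enum_val k).

Lemma of_coefK F A : coef (of_coef F) A = F A.
Proof. by rewrite /coef mxE enum_rankK. Qed.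

Lemma cliffordP x y : coef x =1 coef y -> x = y.
Proof.
by move=> xy; apply/rowP => k; have := xy (enum_val k); rewrite /coef enum_valK.
Qed.

Lemma coefD x y A : coef (x + y) A = coef x A + coef y A.
Proof. exact: mxE. Qed.

Lemma coefN x A : coef (- x) A = - coef x A.
Proof. exact: mxE. Qed.

Lemma coef0 A : coef 0 A = 0.
Proof. exact: mxE. Qed.

Lemma coefZ (k : R) x A : coef (k *: x) A = k * coef x A.
Proof. exact: mxE. Qed.

Lemma coef_sum (I : Type) (r : seq I) (P : pred I) (F : I -> clifford R n) A :
  coef (\sum_(i <- r | P i) F i) A = \sum_(i <- r | P i) coef (F i) A.
Proof. exact: (big_morph (coef^~ A) (fun x y => coefD x y A) (coef0 A)). Qed.

Definition blade A : clifford R n := of_coef (fun B => (B == A)%:R).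

(* The bilinear product with
   blade A * blade B = (-1) ^+ swaps A B *: blade (symdiff A B);
   see blade_mul below. *)
Definition cmul x y : clifford R n := of_coef (fun C =>
  \sum_A (-1) ^+ swaps A (symdiff A C) * (coef x A * coef y (symdiff A C))).

Lemma cmulA : associative cmul.
Proof.
move=> x y z; apply: cliffordP => D; rewrite !of_coefK.
under eq_bigr do rewrite of_coefK !mulr_sumr.
under [RHS]eq_bigr do rewrite of_coefK mulr_suml mulr_sumr.
rewrite [RHS]exchange_big /=; apply: eq_bigr => A _.
rewrite [RHS](reindex_inj (can_inj (symdiffK A))) /=; apply: eq_bigr => B _.
rewrite symdiffK.
have -> : symdiff (symdiff A B) D = symdiff B (symdiff A D).
  by rewrite -symdiffA (symdiffC A) -!symdiffA (symdiffC A).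
set E := symdiff B (symdiff A D).
have sgnE : (-1) ^+ swaps A (symdiff A D) * (-1) ^+ swaps B E =
    (-1) ^+ swaps (symdiff A B) E * (-1) ^+ swaps A B :> R.
  rewrite -!exprD -signr_odd -[RHS]signr_odd !oddD /E !odd_swapsDl !odd_swapsDr.
  by case: (odd (swaps A A)); case: (odd (swaps A B)); case: (odd (swaps A D));
    case: (odd (swaps B A)); case: (odd (swaps B B)); case: (odd (swaps B D)).
rewrite [LHS](_ : _ = (-1) ^+ swaps A (symdiff A D) * (-1) ^+ swaps B E *
  (coef x A * coef y B * coef z E)); last by rewrite [X in _ * X = _]mulrCA !mulrA.
rewrite sgnE -!mulrA; congr (_ * _); rewrite !mulrA; congr (_ * _).
Qed.

Lemma clifford_basis x : x = \sum_A coef x A *: blade A.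
Proof.
apply: cliffordP => B; rewrite coef_sum (bigD1 B) //= coefZ of_coefK eqxx mulr1.
by rewrite big1 ?addr0 // => A /negPf AB; rewrite coefZ of_coefK eq_sym AB mulr0.
Qed.

Lemma cmul1l : left_id (blade finset.set0) cmul.
Proof.
move=> x; apply: cliffordP => C; rewrite of_coefK (bigD1 finset.set0) //=.
rewrite swaps0l expr0 mul1r of_coefK eqxx mul1r sym0diff big1 ?addr0 // => A.
by move=> /negPf A0; rewrite of_coefK A0 mul0r mulr0.
Qed.

Lemma cmul1r : right_id (blade finset.set0) cmul.
Proof.
move=> x; apply: cliffordP => C; rewrite of_coefK (bigD1 C) //=.
rewrite symdiffv swaps0r expr0 mul1r of_coefK eqxx mulr1 big1 ?addr0 // => A.
by move=> /negPf neqAC; rewrite of_coefK symdiff_eq0 neqAC !mulr0.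
Qed.

Lemma cmulDl : left_distributive cmul +%R.
Proof.
move=> x y z; apply: cliffordP => C; rewrite coefD !of_coefK -big_split /=.
by apply: eq_bigr => A _; rewrite coefD mulrDl mulrDr.
Qed.

Lemma cmulDr : right_distributive cmul +%R.
Proof.
move=> x y z; apply: cliffordP => C; rewrite coefD !of_coefK -big_split /=.
by apply: eq_bigr => A _; rewrite coefD mulrDr mulrDr.
Qed.

Lemma cone_neq0 : blade finset.set0 != 0.
Proof.
apply/eqP => /(congr1 (coef^~ finset.set0)) /eqP.
by rewrite of_coefK coef0 eqxx oner_eq0.
Qed.

HB.instance Definition _ := GRing.Zmodule_isNzRing.Build (clifford R n)
  cmulA cmul1l cmul1r cmulDl cmulDr cone_neq0.

Lemma cscaleAl (k : R) x y : k *: (x * y) = (k *: x) * y.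
Proof.
apply: cliffordP => C; rewrite coefZ !of_coefK mulr_sumr.
by apply: eq_bigr => A _; rewrite coefZ mulrCA !mulrA.
Qed.

HB.instance Definition _ :=
  GRing.Lmodule_isLalgebra.Build R (clifford R n) cscaleAl.

Lemma cscaleAr (k : R) x y : k *: (x * y) = x * (k *: y).
Proof.
apply: cliffordP => C; rewrite coefZ !of_coefK mulr_sumr.
by apply: eq_bigr => A _; rewrite coefZ mulrCA; congr (_ * _); rewrite mulrCA.
Qed.

HB.instance Definition _ :=
  GRing.Lalgebra_isAlgebra.Build R (clifford R n) cscaleAr.

Lemma blade0 : blade finset.set0 = 1.
Proof. by []. Qed.

Lemma blade_mul A B :
  blade A * blade B = (-1) ^+ swaps A B *: blade (symdiff A B).
Proof.
apply: cliffordP => C; rewrite coefZ !of_coefK (bigD1 A) //= big1 => [|D /negPf].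
  rewrite addr0 !of_coefK eqxx mul1r; case: eqP => [<-|ACB].
    by rewrite -{3}(symdiffK A C) eqxx.
  by case: eqP => [CAB|_]; [case: ACB; rewrite CAB symdiffK|rewrite !mulr0].
by move=> DA; rewrite of_coefK DA mul0r mulr0.
Qed.

Definition gen (i : 'I_n) : clifford R n := blade (finset.set1 i).

Lemma gen_anticomm i j : gen i * gen j + gen j * gen i = - 2 * (i == j)%:R.
Proof.
rewrite !blade_mul (symdiffC (finset.set1 j)) -scalerDl.
rewrite -signr_odd -[X in _ + X]signr_odd !swaps1.
have [->|ij] := eqVneq i j.
  by rewrite leqnn symdiffv blade0 mulr1 !expr1 scalerDl scaleN1r -opprD.
rewrite mulr0; case: ltngtP => [|| /val_inj ji]; last by rewrite ji eqxx in ij.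
  by rewrite expr0 expr1 addNr scale0r.
by rewrite expr0 expr1 addrN scale0r.
Qed.

Lemma blade_prod (s : seq 'I_n) : sorted ltn (map val s) ->
  \prod_(i <- s) gen i = blade [set i in s]%SET.
Proof.
elim: s => [_|i s IHs /=]; first by rewrite big_nil -blade0 finset.set_nil.
rewrite (path_sortedE ltn_trans) => /andP[/allP lt_is /IHs prodE].
rewrite big_cons prodE blade_mul.
rewrite (_ : swaps _ _ = 0%N); last first.
  apply: eq_card0 => -[k l]; rewrite !inE /=; apply/negP.
  case/and3P=> /eqP-> /(map_f val) /lt_is lt_il.
  by rewrite leqNgt lt_il.
rewrite expr0 scale1r; congr blade; apply/setP => k; rewrite !inE.
case: eqP => // ->; case ins : (i \in s) => //.
by have := lt_is _ (map_f val ins); rewrite ltnn.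
Qed.

Lemma bladeE A : blade A = \prod_(i <- enum A) gen i.
Proof.
rewrite blade_prod; first by congr blade; apply/setP => i; rewrite inE mem_enum.
have : sorted ltn (map val (enum 'I_n)) by rewrite val_enum_ord iota_ltn_sorted.
rewrite (_ : enum A = seq.filter (mem A) (enum 'I_n)) ?enumT // !sorted_map; apply: sorted_filter.
by move=> ? ? ?; apply: ltn_trans.
Qed.

Definition sphere : set (clifford R n) :=
  [set w | exists x : 'I_n -> R,
    \sum_(j < n) x j ^+ 2 = 1 /\ w = \sum_(j < n) x j *: gen j].

Definition paravec (u v : R) (w : clifford R n) : clifford R n :=
  u%:A + v *: w.

Definition slice_domain (a b c : R) : set (clifford R n) :=
  [set x | exists (u v : R) w,
    [/\ u \in `[a, b], v \in `[0, c], sphere w & x = paravec u v w]].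

End CliffordAlgebra.

Section Analysis.
Variable R : realType.
Implicit Types (a b u v x : R).

Definition Gamma x : R :=
  \int[lebesgue_measure]_(t in `]0, +oo[) (t `^ (x - 1) * expR (- t)).

Definition C2_on_line (y : R -> R) : Prop :=
  [/\ forall x, derivable y x 1, forall x, derivable (derive1 y) x 1
    & continuous (derive1 (derive1 y))].

Section VectorValued.
Variable V : normedModType R.
Implicit Type F : R -> V.

(* Families of pairwise disjoint subintervals may be empty or contain
   degenerate intervals. *)
Definition abs_continuous a b F : Prop :=
  forall e : R, 0 < e -> exists2 d : R, 0 < d &
    forall (m : nat) (x y : 'I_m -> R),
      (forall k, a <= x k /\ x k <= y k /\ y k <= b) ->
      trivIset setT (fun k => `]x k, y k[%classic) ->
      \sum_(k < m) (y k - x k) < d ->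
      \sum_(k < m) `|F (y k) - F (x k)| < e.

(* Difference quotients are taken along points of [a, b], so that at an
   endpoint this is the one-sided derivative. *)
Definition diff_quotient F u : R -> V := fun t => (t - u)^-1 *: (F t - F u).

Definition derive_seg a b F u : V :=
  lim (diff_quotient F u t @[t --> within `[a, b] u^']).

Definition C1_seg a b F : Prop :=
  (forall u, u \in `[a, b] ->
     cvg (diff_quotient F u t @[t --> within `[a, b] u^'])) /\
  {within `[a, b], continuous (derive_seg a b F)}.

End VectorValued.

Section CliffordValued.
Variable n : nat.
Implicit Type phi : R -> clifford R n.

Definition cintegral (D : set R) phi : clifford R n :=
  of_coef (fun A => \int[lebesgue_measure]_(t in D) coef (phi t) A).

(* The Riemann-Liouville integral of order 1 - alpha of phi with respect to g,
   based at a. *)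
Definition RL_integral a alpha (g : R -> R) phi u : clifford R n :=
  (Gamma (1 - alpha))^-1 *:
  cintegral `[a, u]%classic (fun t => (derive1 g t / (g u - g t) `^ alpha) *: phi t).

Lemma RL_integral_left a alpha g phi : RL_integral a alpha g phi a = 0.
Proof.
apply: cliffordP => A; rewrite coefZ of_coefK coef0.
by rewrite set_itv1 Rintegral_set1 mulr0.
Qed.

End CliffordValued.
End Analysis.

Section SliceMonogenic.
Variables (R : realType) (n : nat) (a b c r s : R).
Implicit Types (f : clifford R n -> clifford R n) (w : clifford R n).

(* Maps on the slice domain are represented by total maps of which only the
   values on the slice domain are constrained or used. *)

(* f_w^s and f_{w, r} in the usual notation. *)
Definition horizontal f w (t : R) : clifford R n := f (paravec t s w).
Definition vertical f w (t : R) : clifford R n := f (paravec r t w).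

Definition AC1 f : Prop :=
  {within slice_domain a b c, continuous f} /\
  forall w, sphere w ->
    abs_continuous a b (horizontal f w) /\ abs_continuous 0 c (vertical f w).

Definition RL_slice_monogenic (alpha beta : R) (g h : R -> R) f : Prop :=
  AC1 f /\ forall w, sphere w ->
    [/\ C1_seg a b (RL_integral a alpha g (horizontal f w)),
        C1_seg 0 c (RL_integral 0 beta h (vertical f w))
      & forall u v : R, u \in `[a, b] -> v \in `[0, c] ->
        (derive1 g u)^-1 *:
          derive_seg a b (RL_integral a alpha g (horizontal f w)) u +
        w * ((derive1 h v)^-1 *:
          derive_seg 0 c (RL_integral 0 beta h (vertical f w)) v) = 0].

End SliceMonogenic.

(* Main.v *)
Require Import Defs.
From mathcomp Require Import all_boot all_order all_algebra.
From mathcomp Require Import all_classical all_reals all_analysis.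
From mathcomp Require Import measurable_realfun ring lra.
Import Order.TTheory GRing.Theory Num.Theory.
Import numFieldNormedType.Exports.
Local Open Scope classical_set_scope.
Local Open Scope ring_scope.

(** Let A_w and B_w be the Riemann-Liouville integrals of f along the horizontal
    and the vertical line of the slice of the unit w. In the equation
    A_w' u / g' u + w * (B_w' v / h' v) = 0 the variables are separated, so both
    terms are constant. Since w * w = -1 and the integrals vanish at the left
    endpoints, there is a constant K_w with
      A_w u = (g u - g a) K_w   and   B_w v = (h v - h 0) w K_w
    (lemma slice_constant_exists).

    The point is that K_w does not depend on w (slice_constant_common). If s = 0,
    the horizontal line is the real axis, common to all slices. If s > 0, Abel
    inversion of the two identities gives f (t + w s) = p t K_w and
    f (r + w t) = q t (w K_w) with real functions p and q such that q s <> 0.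
    At r + w s this reads (p r - q s w) K_w = 0, and a nonzero paravector in the
    plane of w is invertible, so K_w = 0 for every w.

    With a common K the formula is algebra. Put M = Ix * I; then
    (1 - M) K + (1 + M) K = 2 K, which handles the terms in u, and
    (1 - M) (I K) + (1 + M) (- I K) = - 2 Ix I I K = 2 Ix K, which handles the
    terms in v.

    Abel inversion (abel_inversion) says that a continuous phi whose Abel
    integral of order al is k (g u - g a) equals k / C (g t - g a)^al with
    C <> 0. That this power solves the equation is a substitution in a beta
    integral (kernel_integral_powR). Uniqueness (abel_integral_eq0) follows from
    a maximum principle (primitive_max): if Phi is the primitive of phi g'
    vanishing at a and u maximises Phi on [a, u], then the Abel integral at u is
    at least Phi u / (g u - g a)^al. When all Abel integrals vanish, Phi is
    therefore nowhere positive; applied to - phi this gives Phi = 0, hence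
    phi = 0. *)

Set Implicit Arguments.
Unset Strict Implicit.
Unset Printing Implicit Defensive.

(** * Integrals of nonnegative functions with endpoint singularities *)

Section ImproperFTC.
Variable R : realType.
Notation mu := (@lebesgue_measure R).

(** The integrand may blow up at both endpoints. The usual formula holds on
    compact subintervals growing to the open interval, and nonnegativity lets
    monotone convergence pass to the limit; continuity of F at the endpoints
    makes the limit finite, so integrability comes for free. *)
Lemma ge0_FTC2 (f F : R -> R) a b : a < b ->
  (forall x, x \in `]a, b[ -> 0 <= f x) -> {in `]a, b[, continuous f} ->
  (forall x : R, x \in `]a, b[ -> is_derive x 1 F (f x)) ->
  {within `[a, b], continuous F} ->
  mu.-integrable `[a, b] (EFin \o f) /\
  \int[mu]_(x in `[a, b]) f x = F b - F a.
Proof.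
move=> ab f0 cf dF cF.
have ba0 : 0 < b - a by rewrite subr_gt0.
(* k.+3, not k.+1: the subintervals [a + d k, b - d k] must not degenerate. *)
pose d k := (b - a) / (k.+3)%:R.
have d_gt0 k : 0 < d k by rewrite divr_gt0.
have d2 k : a + d k < b - d k.
  suff : 2 * d k < b - a by lra.
  by rewrite mulrCA gtr_pMr// ltr_pdivrMr// mul1r ltr_nat.
have dle k l : (k <= l)%N -> d l <= d k.
  by move=> kl; rewrite ler_pM2l// lef_pV2 ?posrE// ler_nat.
have d0 : d k @[k --> \oo] --> (0 : R).
  rewrite -(mulr0 (b - a)); apply: cvgM; first exact: cvg_cst.
  by have := @cvg_harmonic R; rewrite -cvg_shiftS -[X in X -> _]cvg_shiftS.
pose E k : set R := `[a + d k, b - d k]%classic.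
have Eab k : E k `<=` `]a, b[.
  move=> x; rewrite /E /= !in_itv/= => /andP[xa xb]; apply/andP; split.
    by rewrite (lt_le_trans _ xa)// ltrDl.
  by rewrite (le_lt_trans xb)// gtrBl.
have UE : \bigcup_k E k = `]a, b[%classic.
  apply/seteqP; split=> [x [k _]|x]; first exact: Eab.
  rewrite /= in_itv/= => /andP[ax xb].
  have [k _ dk] : \forall k \near \oo, d k < Num.min (x - a) (b - x).
    by apply: (cvgr_lt _ d0); rewrite lt_min !subr_gt0 ax xb.
  have := dk k (leqnn k); rewrite lt_min => /andP[dkx dkx'].
  by exists k => //; rewrite /E /= in_itv/=; apply/andP; split; lra.
have mf : measurable_fun `]a, b[ f.
  by apply: open_continuous_measurable_fun => // x; rewrite inE; exact: cf.
have cvgE : (\int[mu]_(x in E k) (f x)%:E)%E @[k --> \oo] -->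
    (\int[mu]_(x in `]a, b[) (f x)%:E)%E.
  rewrite -UE; apply: ge0_nondecreasing_set_cvg_integral => //.
  - move=> k l kl; apply/subsetPset/subset_itv; rewrite bnd_simp.
      by rewrite lerD2l dle.
    by rewrite lerB// dle.
  - by move=> k; apply: measurable_itv.
  - by move=> k; apply/measurable_EFinP; apply: measurable_funS mf => //; exact: Eab.
  - by move=> k x /Eab xab; rewrite lee_fin f0.
have intE k : (\int[mu]_(x in E k) (f x)%:E)%E = (F (b - d k) - F (a + d k))%:E.
  have sub : `]a + d k, b - d k[%classic `<=` `]a, b[.
    by move=> x xab; apply: (Eab k); exact: subset_itv_oo_cc xab.
  rewrite (@continuous_FTC2 _ f F)//.
  - apply: continuous_in_subspaceT => x; rewrite inE => /Eab xab; exact: cf.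
  - split.
    + by move=> x /sub /dF [].
    + apply: cvg_at_right_filter; apply: differentiable_continuous.
      apply/derivable1_diffP; have [] // := dF (a + d k).
      by rewrite in_itv/= ltrDl d_gt0 (lt_trans (d2 k))// gtrBl.
    + apply: cvg_at_left_filter; apply: differentiable_continuous.
      apply/derivable1_diffP; have [] // := dF (b - d k).
      by rewrite in_itv/= gtrBl d_gt0 (lt_trans _ (d2 k))// ltrDl.
  - by move=> x /sub /dF [_]; rewrite derive1E.
have [_ Fa Fb] := (continuous_within_itvP _ ab).1 cF.
have cvgF : (F (b - d k) - F (a + d k))%:E @[k --> \oo] --> (F b - F a)%:E.
  apply: cvg_EFin; first exact: nearW.
  apply: (@cvgB _ R^o).
    apply: (cvg_at_leftP _ _ _).1 Fb _ _; split=> [k|]; first by rewrite gtrBl.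
    by rewrite -{2}(subr0 b); apply: cvgB => //; exact: cvg_cst.
  apply: (cvg_at_rightP _ _ _).1 Fa _ _; split=> [k|]; first by rewrite ltrDl.
  by rewrite -{2}(addr0 a); apply: cvgD => //; exact: cvg_cst.
have intoo : (\int[mu]_(x in `]a, b[) (f x)%:E = (F b - F a)%:E)%E.
  move: cvgE; under eq_fun do rewrite intE.
  by move=> /(cvg_unique _ cvgF) ->.
have intcc : (\int[mu]_(x in `[a, b]) (f x)%:E = (F b - F a)%:E)%E.
  by rewrite integral_itv_bndoo//; exact/measurable_EFinP.
split; last by rewrite /Rintegral intcc.
have mfc : measurable_fun `[a, b] f by exact: measurable_fun_itv_cc mf.
apply/integrableP; split; first exact/measurable_EFinP.
rewrite integral_itv_bndoo; last by apply/measurable_EFinP; exact: measurableT_comp.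
suff -> : (\int[mu]_(x in `]a, b[) `|(EFin \o f) x| =
           \int[mu]_(x in `]a, b[) (f x)%:E)%E by rewrite intoo ltry.
by apply: eq_integral => x; rewrite inE => xab; rewrite /= ger0_norm// f0.
Qed.

End ImproperFTC.

(** * The Abel kernel of a change of variable *)

Section Kernel.
Variable R : realType.
Notation mu := (@lebesgue_measure R).

(** Since x `^ p is 1 at negative x, it is discontinuous at 0; the absolute
    value repairs this. *)
Lemma continuous_normr_powR (p : R) : 0 < p -> continuous (fun x : R => `|x| `^ p).
Proof.
move=> p0 x; have [->|x0] := eqVneq x 0.
  apply/cvgrPdist_lt => e e0; near=> y.
  rewrite normr0 powR0 ?gt_eqF// sub0r normrN ger0_norm ?powR_ge0//.
  have -> : e = (e `^ p^-1) `^ p by rewrite -powRrM mulVf ?gt_eqF// powRr1 ?ltW.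
  rewrite gt0_ltr_powR ?nnegrE ?powR_ge0//.
  near: y; have e'0 : 0 < e `^ p^-1 by rewrite powR_gt0.
  by have /cvgrPdist_lt/(_ _ e'0) := @cvg_id _ (nbhs (0 : R));
    apply: filterS => z; rewrite sub0r normrN.
apply: (@continuous_comp _ _ _ _ (fun y => y `^ p)); first exact: norm_continuous.
apply: differentiable_continuous; apply/derivable1_diffP.
by apply: derivable_powR; rewrite in_itv/= andbT normr_gt0.
Unshelve. all: by end_near. Qed.

Lemma within_continuous_powR (f : R -> R) (p : R) (a b : R) : 0 < p ->
  continuous f -> (forall x, x \in `[a, b] -> 0 <= f x) ->
  {within `[a, b], continuous (fun x => f x `^ p)}.
Proof.
move=> p0 cf f0.
apply: (@subspace_eq_continuous _ _ _ (fun x => `|f x| `^ p)).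
  by move=> x; rewrite inE => xab; rewrite ger0_norm// f0.
apply: continuous_subspaceT => x.
exact: (continuous_comp (cf x) (@continuous_normr_powR p p0 (f x))).
Qed.

Section ChangeOfVariable.
Variables (g : R -> R) (a b : R).
Hypotheses (dg : forall x, derivable g x 1) (cg : continuous (derive1 g)).
Hypothesis g'_gt0 : forall x, x \in `[a, b] -> 0 < derive1 g x.

Let is_dg (x : R) : is_derive x 1 g (derive1 g x).
Proof. by rewrite derive1E; exact: derivableP. Qed.

Let contg : continuous g.
Proof. by move=> x; apply/differentiable_continuous/derivable1_diffP. Qed.

Lemma derive1_gt0_lt : {in `[a, b] &, {homo g : x y / x < y}}.
Proof.
apply: gtr0_derive1_lt_cc => [x _|x xab|]; first exact: dg.
  by apply: g'_gt0; exact: subset_itv_oo_cc xab.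
exact: continuous_subspaceT.
Qed.

Lemma derive1_gt0_le : {in `[a, b] &, {homo g : x y / x <= y}}.
Proof.
move=> x y xab yab; rewrite le_eqVlt => /predU1P[->//|xy].
by apply/ltW/derive1_gt0_lt.
Qed.

Definition abel_kernel (al u t : R) := derive1 g t / (g u - g t) `^ al.

Lemma is_derive_gap_powR (p u t : R) : g t < g u ->
  is_derive t 1 (fun t => (g u - g t) `^ p)
    (- (p * (g u - g t) `^ (p - 1) * derive1 g t)).
Proof.
move=> tu; have tu0 : 0 < g u - g t by rewrite subr_gt0.
have d1 : is_derive t 1 (fun t => g u - g t) (- derive1 g t).
  by have := is_deriveB (is_derive_cst (g u) t 1) (is_dg t); rewrite sub0r.
have := @is_derive1_comp _ (fun y => y `^ p) _ t _ _ (is_derive1_powR p tu0) d1.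
by rewrite mulrN.
Qed.

Lemma continuous_kernel al u t : g t < g u -> {for t, continuous (abel_kernel al u)}.
Proof.
move=> tu; apply: continuousM; first exact: cg.
apply: continuousV; first by rewrite gt_eqF// powR_gt0// subr_gt0.
apply: differentiable_continuous; apply/derivable1_diffP.
by have [] := is_derive_gap_powR al tu.
Qed.

Lemma kernel_ge0 al u t : t \in `[a, b] -> 0 <= abel_kernel al u t.
Proof. by move=> tab; rewrite divr_ge0 ?powR_ge0// ltW// g'_gt0. Qed.

Lemma integrable_kernel al u : al < 1 -> a < u <= b ->
  mu.-integrable `[a, u] (EFin \o abel_kernel al u).
Proof.
move=> al1 /andP[au ub].
have sub t : t \in `[a, u] -> t \in `[a, b].
  by apply: subset_itvl; rewrite bnd_simp.
have uab : u \in `[a, b] by rewrite in_itv/= ub ltW.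
have subo t : t \in `]a, u[ -> t \in `[a, b].
  by move=> /subset_itv_oo_cc /sub.
have lt t : t \in `]a, u[ -> g t < g u.
  by move=> tau; apply: derive1_gt0_lt => //; [exact: subo|rewrite (itvP tau)].
have al0 : 0 < 1 - al by rewrite subr_gt0.
(* F is a primitive of the kernel, continuous up to t = u because al < 1. *)
pose F t := - (1 - al)^-1 * (g u - g t) `^ (1 - al).
apply: (proj1 (@ge0_FTC2 _ (abel_kernel al u) F a u au _ _ _ _)).
- by move=> t tau; apply: kernel_ge0; exact: subo.
- by move=> t tau; apply: continuous_kernel; exact: lt.
- move=> t tau; have := is_derive_gap_powR (1 - al) (lt t tau) => d.
  have := @is_deriveZ _ _ _ _ (- (1 - al)^-1) t 1 _ d.
  rewrite [X in is_derive _ _ _ X](_ : _ = abel_kernel al u t) //.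
  rewrite /GRing.scale/= mulrNN -mulrA mulKf ?gt_eqF// addrAC subrr sub0r powRN.
  by rewrite /abel_kernel mulrC.
- have cw : {within `[a, u], continuous (fun t => (g u - g t) `^ (1 - al))}.
    apply: within_continuous_powR => // [t|t /[dup] tau /sub tab].
      by apply: continuousB; [exact: cst_continuous|exact: contg].
    by rewrite subr_ge0 derive1_gt0_le// (itvP tau).
  move=> t; apply: (@continuousM _ _ (cst (- (1 - al)^-1)) _ t).
    exact: cst_continuous.
  exact: cw.
Qed.

Lemma integrable_kernelM al u (phi : R -> R) : al < 1 -> u \in `[a, b] ->
  {within `[a, b], continuous phi} ->
  mu.-integrable `[a, u] (EFin \o (fun t => abel_kernel al u t * phi t)).
Proof.
move=> al1; rewrite in_itv/= => /andP[]; rewrite le_eqVlt => /predU1P[<- _ _|au ub cphi].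
  rewrite set_itv1; apply: null_set_integrable => //; last exact: lebesgue_measure_set1.
  by apply: measurable_fun_set1.
have cphiu : {within `[a, u], continuous phi}.
  by apply: continuous_subspaceW cphi; apply: subset_itvl; rewrite bnd_simp.
have := @integrableMl _ _ _ mu `[a, u] _ _ phi (@integrable_kernel al u al1 _).
apply => //.
- by rewrite au.
- exact: subspace_continuous_measurable_fun.
- have /compact_bounded[M [_ mrt]] := continuous_compact cphiu (@segment_compact _ a u).
  by exists M; split; rewrite ?num_real // => ? ? ? ?; exact: mrt.
Qed.

End ChangeOfVariable.
End Kernel.

(** * Abel integrals of powers *)

Section BetaIntegral.
Variable R : realType.
Notation mu := (@lebesgue_measure R).

Lemma within_continuous_maps (q f : R -> R) (a b c d : R) : continuous q ->
  (forall t, t \in `[a, b] -> q t \in `[c, d]) -> {within `[c, d], continuous f} ->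
  {within `[a, b], continuous (fun t => f (q t))}.
Proof.
move=> cq qab /subspace_continuousP cf; apply/subspace_continuousP => t tab W fW.
have H : \forall x \near t, q x \in `[c, d] -> W (f (q x)).
  exact: (cq t _ (cf (q t) (qab t tab) W fW)).
suff : \forall x \near t, x \in `[a, b] -> W (f (q x)) by [].
by apply: filterS H => x Wx xab; apply/Wx/qab.
Qed.

(** Writing the weight (1 - y)^(- al) as the kernel of the identity map makes
    the integrability results on kernels apply to it. *)
Definition beta_integrand (al y : R) : R := abel_kernel id al 1 y * y `^ al.

(** The Euler beta value B(1 + al, 1 - al). *)
Definition beta_const (al : R) : R := \int[mu]_(y in `[0, (1 : R)]) beta_integrand al y.

Lemma derive1_idE : derive1 (id : R -> R) = cst 1.
Proof. by apply/funext => x; rewrite derive1E derive_id. Qed.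

Lemma integrable_beta (al : R) : 0 < al < 1 ->
  mu.-integrable `[0, 1] (EFin \o beta_integrand al).
Proof.
move=> /andP[al0 al1].
apply: (@integrable_kernelM R id 0 1) => //.
- by rewrite derive1_idE; exact: cst_continuous.
- by move=> x _; rewrite derive1_idE.
- by rewrite in_itv/= lexx ler01.
- by apply: within_continuous_powR => // x; [exact: cvg_id|rewrite in_itv/= => /andP[]].
Qed.

Lemma continuous_beta_integrand (al y : R) : 0 < y < 1 ->
  {for y, continuous (beta_integrand al)}.
Proof.
move=> /andP[y0 y1]; apply: continuousM.
  apply: continuous_kernel => //.
  by rewrite derive1_idE; exact: cst_continuous.
apply: differentiable_continuous; apply/derivable1_diffP.
by apply: derivable_powR; rewrite in_itv/= andbT.
Qed.

Section ChangeOfVariable.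
Variables (g : R -> R) (a b : R).
Hypotheses (dg : forall x : R, derivable g x 1) (cg : continuous (derive1 g)).
Hypothesis g'_gt0 : forall x, x \in `[a, b] -> 0 < derive1 g x.

Let is_dg (x : R) : is_derive x 1 g (derive1 g x).
Proof. by rewrite derive1E; exact: derivableP. Qed.

Let contg : continuous g.
Proof. by move=> x; apply/differentiable_continuous/derivable1_diffP. Qed.

(** This is the substitution y = (g t - g a) / (g u - g a) in the beta integral.
    The integrand is singular at t = u, so the substitution is carried out on
    primitives: if B is a primitive of the beta integrand and q the
    substitution, then L * B (q t) is a primitive of the integrand on the left. *)
Lemma kernel_integral_powR (al u : R) : 0 < al < 1 -> u \in `[a, b] ->
  \int[mu]_(t in `[a, u]) (abel_kernel g al u t * (g t - g a) `^ al) =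
  beta_const al * (g u - g a).
Proof.
move=> al01; rewrite in_itv/= => /andP[]; rewrite le_eqVlt => /predU1P[<- _|au ub].
  by rewrite set_itv1 Rintegral_set1 subrr mulr0.
have sub t : t \in `[a, u] -> t \in `[a, b].
  by apply: subset_itvl; rewrite bnd_simp.
have gab := derive1_gt0_lt dg g'_gt0.
have uau : u \in `[a, u] by rewrite in_itv/= lexx ltW.
have aau : a \in `[a, u] by rewrite in_itv/= lexx ltW.
have L0 : 0 < g u - g a by rewrite subr_gt0 gab// sub.
set L := g u - g a in L0 *.
pose q t := (g t - g a) / L.
pose B y := parameterized_integral mu 0 y (beta_integrand al).
have ib := integrable_beta al01.
have cB : {within `[0, 1], continuous B} by exact: parameterized_integral_continuous.
have q01 t : t \in `]a, u[ -> 0 < q t < 1.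
  move=> tau; have tau' := subset_itv_oo_cc tau.
  rewrite divr_gt0//= ?ltr_pdivrMr ?mul1r ?ltrD2r ?subr_gt0 ?gab ?sub//;
    by rewrite (itvP tau).
have dq (t : R) : is_derive t 1 q (derive1 g t / L).
  have -> : q = L^-1 \*: (g \- cst (g a)).
    by apply/funext => x; rewrite /q mulrC.
  have := is_deriveZ L^-1 (is_deriveB (is_dg t) (is_derive_cst (g a) t 1)).
  by rewrite subr0 mulrC.
have dB (y : R) : 0 < y < 1 -> is_derive y 1 B (beta_integrand al y).
  move=> /[dup] y01 /andP[y0 y1].
  have [dBy <-] := continuous_FTC1_closed y1 ib y0 (@continuous_beta_integrand al y y01).
  by rewrite derive1E; exact: derivableP.
pose F t := L * B (q t).
have qa : q a = 0 by rewrite /q subrr mul0r.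
have qu : q u = 1 by rewrite /q divff// gt_eqF.
have -> : beta_const al * L = F u - F a.
  rewrite /F qu qa {2}/B /parameterized_integral set_itv1 Rintegral_set1 mulr0 subr0.
  by rewrite mulrC.
apply: (proj2 (@ge0_FTC2 _ _ F a u au _ _ _ _)).
- move=> t /subset_itv_oo_cc tau; rewrite mulr_ge0 ?powR_ge0//.
  by apply: (kernel_ge0 g'_gt0); exact: sub.
- move=> t tau; have tau' := subset_itv_oo_cc tau; apply: continuousM.
    apply: (continuous_kernel dg cg).
    by rewrite gab ?sub// (itvP tau).
  have ta : 0 < g t - g a by rewrite subr_gt0 gab ?sub// (itvP tau).
  have c1 : {for t, continuous (fun x => g x - g a)}.
    by apply: continuousB; [exact: contg|exact: cst_continuous].
  apply: (@continuous_comp _ _ _ _ (fun y => y `^ al) t c1).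
  apply: differentiable_continuous; apply/derivable1_diffP.
  by apply: derivable_powR; rewrite in_itv/= andbT.
- move=> t tau; have tau' := subset_itv_oo_cc tau.
  have := is_deriveZ L (@is_derive1_comp _ B q t _ _ (dB _ (q01 _ tau)) (dq t)).
  rewrite [X in is_derive _ _ _ X](_ : _ = abel_kernel g al u t * (g t - g a) `^ al) //.
  rewrite /GRing.scale/= /beta_integrand /abel_kernel derive1_idE /cst.
  have -> : 1 - q t = (g u - g t) / L.
    by rewrite /q -{1}(@divff _ L) ?gt_eqF// -mulrBl /L; congr (_ / _); ring.
  have gt1 : 0 <= g u - g t by rewrite subr_ge0 ltW// gab ?sub// (itvP tau).
  have gt2 : 0 < g u - g t by rewrite subr_gt0 gab ?sub// (itvP tau).
  have gt3 : 0 < g t - g a by rewrite subr_gt0 gab ?sub// (itvP tau).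
  rewrite /q !powRM ?invr_ge0 ?(ltW L0) ?(ltW gt3)//.
  have : (L^-1) `^ al != 0 by rewrite gt_eqF// powR_gt0// invr_gt0.
  have : (g u - g t) `^ al != 0 by rewrite gt_eqF// powR_gt0.
  have : L != 0 by rewrite gt_eqF.
  move: (_ `^ al) (_ `^ al) (_ `^ al) => x y z L1 x1 y1.
  by field; rewrite ?L1 ?x1 ?y1.
- have cq : continuous q.
    by move=> t; apply/differentiable_continuous/derivable1_diffP; have [] := dq t.
  have q01c t : t \in `[a, u] -> q t \in `[0, 1].
    move=> tau; rewrite in_itv/= divr_ge0 ?(ltW L0)//=; last first.
      by rewrite subr_ge0 (derive1_gt0_le dg g'_gt0)// ?sub// (itvP tau).
    rewrite ler_pdivrMr// mul1r lerD2r.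
    by rewrite (derive1_gt0_le dg g'_gt0)// ?sub// (itvP tau).
  have cBq := within_continuous_maps cq q01c cB.
  by move=> t; apply: (@continuousM _ _ (cst L) _ t); [exact: cst_continuous|exact: cBq].
Qed.

End ChangeOfVariable.
End BetaIntegral.

(** * A maximum principle for Abel integrals *)

Section Uniqueness.
Variable R : realType.
Notation mu := (@lebesgue_measure R).
Variables (g : R -> R) (a b : R).
Hypotheses (dg : forall x : R, derivable g x 1) (cg : continuous (derive1 g)).
Hypothesis g'_gt0 : forall x, x \in `[a, b] -> 0 < derive1 g x.
Variable al : R.
Hypothesis al01 : 0 < al < 1.

Let is_dg (x : R) : is_derive x 1 g (derive1 g x).
Proof. by rewrite derive1E; exact: derivableP. Qed.

Let contg : continuous g.
Proof. by move=> x; apply/differentiable_continuous/derivable1_diffP. Qed.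

Definition primitive (phi : R -> R) (x : R) : R :=
  parameterized_integral mu a x (fun t => phi t * derive1 g t).

Lemma integrable_density (phi : R -> R) : {within `[a, b], continuous phi} ->
  mu.-integrable `[a, b] (EFin \o (fun t => phi t * derive1 g t)).
Proof.
move=> cphi; apply: continuous_compact_integrable; first exact: segment_compact.
by move=> x; apply: continuousM; [exact: cphi|exact: continuous_subspaceT].
Qed.

Lemma is_derive_primitive (phi : R -> R) (t : R) : {within `[a, b], continuous phi} ->
  t \in `]a, b[ -> is_derive t 1 (primitive phi) (phi t * derive1 g t).
Proof.
move=> cphi tab; have [at_ tb] : a < t /\ t < b by rewrite !(itvP tab).
have ct : {for t, continuous (fun t => phi t * derive1 g t)}.
  apply: continuousM; last exact: cg.
  exact: (within_continuous_continuous (lt_trans at_ tb) cphi tab).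
have [d <-] := continuous_FTC1_closed tb (integrable_density cphi) at_ ct.
by rewrite derive1E; exact: derivableP.
Qed.

(** The Abel integral of phi is, up to a factor, the Caputo derivative of order
    al of the primitive Phi of phi * g', and at a maximum point such a derivative
    is bounded below by the boundary term Phi u / (g u - g a)^al. The proof is an
    integration by parts in disguise: T y, the Abel integral truncated at y plus
    the boundary term (Phi u - Phi y) * (g u - g y)^(- al), has derivative
    (Phi u - Phi y) * (d/dy) (g u - g y)^(- al), which is nonnegative at a
    maximum. Hence T a is at most the limit of T at u, and there the boundary
    term vanishes since Phi u - Phi y is at most a multiple of g u - g y. *)
Lemma primitive_max (phi : R -> R) u : {within `[a, b], continuous phi} ->
  a < u <= b ->
  (forall t, t \in `[a, u] -> primitive phi t <= primitive phi u) ->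
  primitive phi u / (g u - g a) `^ al <=
    \int[mu]_(t in `[a, u]) (abel_kernel g al u t * phi t).
Proof.
move=> cphi /andP[au ub] umax.
have [al0 al1] := andP al01.
have sub t : t \in `[a, u] -> t \in `[a, b].
  by apply: subset_itvl; rewrite bnd_simp.
have subo t : t \in `]a, u[ -> t \in `]a, b[.
  by apply: subset_itvl; rewrite bnd_simp.
have gab := derive1_gt0_lt dg g'_gt0.
have uau : u \in `[a, u] by rewrite in_itv/= lexx ltW.
have aau : a \in `[a, u] by rewrite in_itv/= lexx ltW.
have gu t : t \in `[a, u[ -> g t < g u.
  by move=> tau; rewrite gab ?sub ?(itvP tau)//; exact: subset_itv_co_cc tau.
have cphiu : {within `[a, u], continuous phi}.
  by apply: continuous_subspaceW cphi; apply: subset_itvl; rewrite bnd_simp.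
have iphi : mu.-integrable `[a, u] (EFin \o (fun t => phi t * derive1 g t)).
  have sub' : `[a, u]%classic `<=` `[a, b] by move=> x; exact: sub.
  exact: (@integrableS _ _ R mu _ _ _ (measurable_itv _) (measurable_itv _) sub'
    (integrable_density cphi)).
have ik := integrable_kernelM dg cg g'_gt0 al1 (sub _ uau) cphi.
pose P y := parameterized_integral mu a y (fun t => abel_kernel g al u t * phi t).
pose k (y : R) := (g u - g y) `^ (- al).
pose Q y := primitive phi u - primitive phi y.
pose T y := P y + Q y * k y.
have cPsi : {within `[a, u], continuous (primitive phi)}.
  by apply: parameterized_integral_continuous => //; exact: ltW.
have cP : {within `[a, u], continuous P}.
  by apply: parameterized_integral_continuous => //; exact: ltW.
have dk t : t \in `[a, u[ -> is_derive t 1 k (al * (g u - g t) `^ (- al - 1) * derive1 g t).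
  by move=> /gu tu; have := is_derive_gap_powR dg (- al) tu; rewrite !mulNr opprK.
have dT t : t \in `]a, u[ ->
    is_derive t 1 T (Q t * (al * (g u - g t) `^ (- al - 1) * derive1 g t)).
  move=> tau; have tau' := subset_itv_oo_co tau.
  have [at_ tu] : a < t /\ t < u by rewrite !(itvP tau).
  have dP : is_derive t 1 P (abel_kernel g al u t * phi t).
    have ct : {for t, continuous (fun t => abel_kernel g al u t * phi t)}.
      apply: continuousM; first exact: (continuous_kernel dg cg (gu _ tau')).
      exact: (within_continuous_continuous (lt_le_trans au ub) cphi (subo _ tau)).
    have [d <-] := continuous_FTC1_closed tu ik at_ ct.
    by rewrite derive1E; exact: derivableP.
  have dQ : is_derive t 1 Q (- (phi t * derive1 g t)).
    have := is_deriveB (is_derive_cst (primitive phi u) t 1)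
      (is_derive_primitive cphi (subo _ tau)).
    by rewrite sub0r.
  have := is_deriveD dP (is_deriveM dQ (dk _ tau')).
  rewrite [X in is_derive _ _ _ X](_ : _ =
    Q t * (al * (g u - g t) `^ (- al - 1) * derive1 g t))//.
  by rewrite /GRing.scale/= /k /abel_kernel powRN; ring.
have Ta : T a = primitive phi u / (g u - g a) `^ al.
  rewrite /T /P /Q /k {2}/primitive /parameterized_integral set_itv1 !Rintegral_set1.
  by rewrite add0r subr0 powRN.
have TaT t : t \in `[a, u[ -> T a <= T t.
  move=> tau; apply: (@ger0_derive1_le_co _ T a u) => //.
  - by move=> x /dT [].
  - move=> x /[dup] xau /dT [_ dTx]; rewrite derive1E dTx.
    rewrite !mulr_ge0 ?powR_ge0 ?(ltW al0)//.
      by rewrite subr_ge0 umax//; exact: subset_itv_oo_cc xau.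
    by rewrite ltW// g'_gt0// sub//; exact: subset_itv_oo_cc xau.
  - have sco : `[a, u[%classic `<=` `[a, u] by move=> x; exact: subset_itv_co_cc.
    have cP' := continuous_subspaceW sco cP.
    have cPsi' := continuous_subspaceW sco cPsi.
    have ck : {within `[a, u[, continuous k}.
      apply: derivable_within_continuous => x xau.
      by have [] := dk x xau.
    move=> x; apply: continuousD; first exact: cP'.
    apply: continuousM; last exact: ck.
    by apply: continuousB; [exact: cst_continuous|exact: cPsi'].
  - by rewrite in_itv/= lexx au.
  - by rewrite (itvP tau).
have [M M0 Mphi] : exists2 M, 0 < M & forall t, t \in `[a, u] -> phi t <= M.
  have [c _ cmax] := EVT_max (ltW au) cphiu.
  exists (`|phi c| + 1); first by rewrite ltr_wpDl.
  by move=> t /cmax /le_trans; apply; rewrite (le_trans (ler_norm _))// lerDl.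
have QM t : t \in `[a, u] -> Q t <= M * (g u - g t).
  move=> tau; pose W y := primitive phi y - M * g y.
  suff : W u <= W t by rewrite /W /Q mulrBr; lra.
  have dW x : x \in `]a, u[ -> is_derive x 1 W ((phi x - M) * derive1 g x).
    move=> /subo xab.
    have := is_deriveB (is_derive_primitive cphi xab) (is_deriveZ M (is_dg x)).
    by rewrite /GRing.scale/= -mulrBl.
  apply: (@ler0_derive1_le_cc _ W a u) => //.
  - by move=> x /dW [].
  - move=> x /[dup] xau /dW [_ dWx]; rewrite derive1E dWx.
    have xau' := subset_itv_oo_cc xau.
    by rewrite mulr_le0_ge0 ?subr_le0 ?Mphi// ltW// g'_gt0// sub.
  - move=> x; apply: continuousB; first exact: cPsi.
    move: x; apply: (@continuous_subspaceT _ _ _ (fun y => M * g y)) => y.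
    by apply: continuousM; [exact: cst_continuous|exact: contg].
  - by rewrite (itvP tau).
have cgap : {within `[a, u], continuous (fun y => (g u - g y) `^ (1 - al))}.
  apply: within_continuous_powR; first by rewrite subr_gt0.
    by move=> t; apply: continuousB; [exact: cst_continuous|exact: contg].
  move=> t tau.
  by rewrite subr_ge0 (derive1_gt0_le dg g'_gt0)// ?sub// (itvP tau).
have lim : P y + M * (g u - g y) `^ (1 - al) @[y --> u^'-] --> P u.
  rewrite -[X in _ --> X]addr0 -(mulr0 M); apply: cvgD.
    by have [] := (continuous_within_itvP _ au).1 cP.
  apply: cvgM; first exact: cvg_cst.
  have [_ _] := (continuous_within_itvP _ au).1 cgap.
  by rewrite subrr powR0// gt_eqF// subr_gt0.
rewrite -Ta; apply: (cvgr_to_ge lim).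
near=> y.
have yau : y \in `[a, u[.
  rewrite in_itv/=; apply/andP; split; near: y; first exact: nbhs_left_ge.
  exact: nbhs_left_lt.
apply: (le_trans (TaT y yau)); rewrite lerD2l.
have gy : 0 < g u - g y by rewrite subr_gt0 gu.
have -> : (g u - g y) `^ (1 - al) = (g u - g y) * k y.
  by rewrite powRD ?powRr1 ?(ltW gy)//; apply/implyP => _; rewrite gt_eqF.
rewrite mulrA.
by apply: ler_wpM2r; [exact: powR_ge0|apply: QM; exact: subset_itv_co_cc yau].
Unshelve. all: by end_near. Qed.

End Uniqueness.

(** * Abel inversion *)

Section AbelInversion.
Variable R : realType.
Notation mu := (@lebesgue_measure R).
Variables (g : R -> R) (a b : R).
Hypotheses (dg : forall x : R, derivable g x 1) (cg : continuous (derive1 g)).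
Hypothesis g'_gt0 : forall x, x \in `[a, b] -> 0 < derive1 g x.
Variable al : R.
Hypotheses (al01 : 0 < al < 1) (ab : a < b).

Definition abel_integral (phi : R -> R) (u : R) : R :=
  \int[mu]_(t in `[a, u]) (abel_kernel g al u t * phi t).

Lemma abel_integral0 (u : R) : abel_integral (cst 0) u = 0.
Proof.
rewrite /abel_integral (eq_Rintegral _ _ (g := cst 0)); last by move=> x _; rewrite mulr0.
by rewrite Rintegral_cst// mul0r.
Qed.

Lemma abel_integralB_scale (phi psi : R -> R) (k u : R) : u \in `[a, b] ->
  {within `[a, b], continuous phi} -> {within `[a, b], continuous psi} ->
  abel_integral (fun t => phi t - k * psi t) u =
    abel_integral phi u - k * abel_integral psi u.
Proof.
have [al0 al1] := andP al01.
move=> uab cphi cpsi.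
have i1 := integrable_kernelM dg cg g'_gt0 al1 uab cphi.
have i2 := integrable_kernelM dg cg g'_gt0 al1 uab cpsi.
have i3 : mu.-integrable `[a, u] (EFin \o (fun t => k * (abel_kernel g al u t * psi t))).
  exact: (@integrableZl _ _ _ mu _ (measurable_itv _) k _ i2).
rewrite /abel_integral -RintegralZl// -RintegralB//.
by apply: eq_Rintegral => t _; rewrite mulrBr [in RHS]mulrCA.
Qed.

Lemma within_continuousB_scale (A : set R) (phi psi : R -> R) (k : R) :
  {within A, continuous phi} -> {within A, continuous psi} ->
  {within A, continuous (fun t => phi t - k * psi t)}.
Proof.
move=> /subspace_continuousP cphi /subspace_continuousP cpsi.
apply/subspace_continuousP => x Ax.
by apply: cvgB; [exact: cphi|apply: cvgM; [exact: cvg_cst|exact: cpsi]].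
Qed.

(** The maximum of the primitive over the whole segment is attained either at
    the left endpoint, where the primitive is 0, or at a point where the maximum
    principle applies. *)
Lemma primitive_le0 (phi : R -> R) : {within `[a, b], continuous phi} ->
  (forall u, u \in `[a, b] -> abel_integral phi u = 0) ->
  forall t, t \in `[a, b] -> primitive g a phi t <= 0.
Proof.
move=> cphi phi0 t tab.
have cPsi : {within `[a, b], continuous (primitive g a phi)}.
  apply: parameterized_integral_continuous; first exact: ltW.
  exact: integrable_density.
have [c cab cmax] := EVT_max (ltW ab) cPsi.
apply: (le_trans (cmax _ tab)).
move: (cab); rewrite in_itv/= => /andP[]; rewrite le_eqVlt => /predU1P[<- _|ac cb].
  by rewrite /primitive /parameterized_integral set_itv1 Rintegral_set1.
have acb : a < c <= b by rewrite ac.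
have := primitive_max dg cg g'_gt0 al01 cphi acb.
rewrite -/(abel_integral phi c) phi0//.
have aab : a \in `[a, b] by rewrite in_itv/= lexx ltW.
rewrite pmulr_lle0; last by rewrite invr_gt0 powR_gt0// subr_gt0 (derive1_gt0_lt dg g'_gt0).
by apply=> x xac; apply: cmax; apply: subset_itvl xac; rewrite bnd_simp.
Qed.

(** Uniqueness for Abel's equation: the bound on primitives applies to phi and to
    - phi, so the primitive of phi * g' vanishes identically, and so does its
    derivative. *)
Lemma abel_integral_eq0 (phi : R -> R) : {within `[a, b], continuous phi} ->
  (forall u, u \in `[a, b] -> abel_integral phi u = 0) ->
  forall t, t \in `[a, b] -> phi t = 0.
Proof.
move=> cphi phi0.
have cphiN : {within `[a, b], continuous (fun t => - phi t)}.
  by move=> x; apply: continuousN; exact: cphi.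
have phiN0 u : u \in `[a, b] -> abel_integral (fun t => - phi t) u = 0.
  move=> uab; have := @abel_integralB_scale (cst 0) phi 1 u uab _ cphi.
  rewrite phi0// mulr0 subr0 abel_integral0.
  move=> <-; last exact: cst_continuous.
  by apply: eq_Rintegral => x _; rewrite /= mul1r sub0r.
have Psi0 t : t \in `[a, b] -> primitive g a phi t = 0.
  move=> tab; apply/eqP; rewrite eq_le primitive_le0//=.
  have := primitive_le0 cphiN phiN0 tab.
  suff -> : primitive g a (fun t => - phi t) t = - primitive g a phi t by rewrite oppr_le0.
  rewrite -mulN1r /primitive /parameterized_integral -RintegralZl//.
    by apply: eq_Rintegral => x _; rewrite mulN1r mulNr.
  have sub' : `[a, t]%classic `<=` `[a, b].
    by apply: subset_itvl; rewrite bnd_simp (itvP tab).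
  exact: (@integrableS _ _ R mu _ _ _ (measurable_itv _) (measurable_itv _) sub'
    (integrable_density cg cphi)).
have phioo t : t \in `]a, b[ -> phi t = 0.
  move=> tab; have [_] := is_derive_primitive cg cphi tab.
  have near0 : \forall x \near t, cst 0 x = primitive g a phi x.
    near=> x; rewrite Psi0//; near: x.
    by apply: filterS (near_in_itvoo tab) => x; exact: subset_itv_oo_cc.
  rewrite -(near_eq_derive _ near0) derive_cst => /esym/eqP.
  rewrite mulf_eq0 [X in _ || X]gt_eqF ?orbF; first by move/eqP.
  by apply: g'_gt0; exact: subset_itv_oo_cc tab.
have [_ ca cb] := (continuous_within_itvP _ ab).1 cphi.
move=> t; rewrite in_itv/= => /andP[].
rewrite le_eqVlt => /predU1P[<- _|at_].
  apply: (cvg_unique _ ca); first exact: norm_hausdorff.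
  apply: cvg_near_cst; near=> x; apply: phioo.
  by rewrite in_itv/=; apply/andP; split; near: x; [exact: nbhs_right_gt|exact: nbhs_right_lt].
rewrite le_eqVlt => /predU1P[->|tb]; last by rewrite phioo// in_itv/= at_.
apply: (cvg_unique _ cb); first exact: norm_hausdorff.
apply: cvg_near_cst; near=> x; apply: phioo.
by rewrite in_itv/=; apply/andP; split; near: x; [exact: nbhs_left_gt|exact: nbhs_left_lt].
Unshelve. all: by end_near. Qed.

Let e (t : R) := (g t - g a) `^ al.

Let ce : {within `[a, b], continuous e}.
Proof.
have [al0 al1] := andP al01.
apply: within_continuous_powR => // [t|t tab].
  apply: continuousB; last exact: cst_continuous.
  by apply/differentiable_continuous/derivable1_diffP.
by rewrite subr_ge0 (derive1_gt0_le dg g'_gt0)// ?(itvP tab)// in_itv/= lexx ltW.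
Qed.

Let gab0 : 0 < g b - g a.
Proof. by rewrite subr_gt0 (derive1_gt0_lt dg g'_gt0)// in_itv/= lexx ltW. Qed.

(** If the constant were 0, the power (g - g a)^al would have a zero Abel
    integral, against uniqueness. *)
Lemma beta_const_neq0 : beta_const al != 0.
Proof.
apply/negP => /eqP C0.
have bab : b \in `[a, b] by rewrite in_itv/= lexx ltW.
have e0 u : u \in `[a, b] -> abel_integral e u = 0.
  move=> uab; rewrite /abel_integral /e.
  by rewrite (kernel_integral_powR dg cg g'_gt0 al01 uab) C0 mul0r.
have /eqP := abel_integral_eq0 ce e0 bab.
by apply/negP; rewrite /e gt_eqF// powR_gt0.
Qed.

(** The right-hand side solves the same Abel equation as phi, so uniqueness
    identifies them. *)
Lemma abel_inversion (phi : R -> R) (k : R) : {within `[a, b], continuous phi} ->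
  (forall u, u \in `[a, b] -> abel_integral phi u = k * (g u - g a)) ->
  forall t, t \in `[a, b] -> phi t = k / beta_const al * (g t - g a) `^ al.
Proof.
move=> cphi phiE t tab; apply/eqP; rewrite -subr_eq0; apply/eqP.
set k' := k / _.
apply: (@abel_integral_eq0 (fun t => phi t - k' * e t)) => //.
  exact: within_continuousB_scale.
move=> u uab; rewrite abel_integralB_scale// phiE// /abel_integral.
rewrite (kernel_integral_powR dg cg g'_gt0 al01 uab).
by rewrite /k' mulrA divfK ?subrr// beta_const_neq0.
Qed.

End AbelInversion.

(** * Clifford-valued Riemann-Liouville integrals *)

Section CliffordValuedCalculus.
Variables (R : realType) (n : nat).
Notation mu := (@lebesgue_measure R).
Implicit Types (F phi : R -> clifford R n) (K N w : clifford R n).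

Lemma continuous_coef (A : {set 'I_n}) : continuous (fun x : clifford R n => coef x A).
Proof. exact: coord_continuous. Qed.

Lemma abs_continuous_coef (a b : R) F (A : {set 'I_n}) : abs_continuous a b F ->
  {within `[a, b], continuous (fun t => coef (F t) A)}.
Proof.
move=> acF; apply/subspace_continuousP => x; rewrite /= in_itv/= => /andP[ax xb].
suff cF : F t @[t --> within `[a, b] (nbhs x)] --> F x.
  exact: (cvg_comp _ _ cF (@continuous_coef A (F x))).
apply/cvgrPdist_lt => e e0; have [d d0 acd] := acF e e0.
have acd2 y z : a <= y -> y <= z -> z <= b -> z - y < d -> `|F z - F y| < e.
  move=> ay yz zb zyd; have := acd 1 (fun=> y) (fun=> z).
  rewrite !big_ord1; apply => //; move=> i j _ _ _; by rewrite !ord1.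
have H : \forall t \near x, t \in `[a, b] -> `|F x - F t| < e.
  near=> t; rewrite in_itv/= => /andP[at_ tb].
  have xtd : `|x - t| < d.
    by near: t; have /cvgrPdist_lt/(_ _ d0) := @cvg_id _ (nbhs x).
  have [xt|tx] := leP x t.
    by rewrite distrC acd2//; rewrite -(ger0_norm (_ : 0 <= t - x)) ?subr_ge0// distrC.
  by rewrite acd2// 1?ltW//; rewrite -(gtr0_norm (_ : 0 < x - t)) ?subr_gt0.
exact: H.
Unshelve. all: by end_near. Qed.

Lemma coef_RL_integral (a al : R) (g : R -> R) phi (u : R) (A : {set 'I_n}) :
  coef (RL_integral a al g phi u) A =
  (Gamma (1 - al))^-1 * abel_integral g a al (fun t => coef (phi t) A) u.
Proof.
rewrite Defs.coefZ of_coefK; congr (_ * _).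
by apply: eq_Rintegral => t _; rewrite Defs.coefZ.
Qed.

Section ChangeOfVariable.
Variables (g : R -> R) (a b al : R).
Hypotheses (dg : forall x : R, derivable g x 1) (cg : continuous (derive1 g)).
Hypothesis g'_gt0 : forall x, x \in `[a, b] -> 0 < derive1 g x.
Hypotheses (al01 : 0 < al < 1) (ab : a < b).

(** Continuity is part of the conclusion because the induction on r needs it to
    split the integral of the tail. *)
Lemma abel_integral_sum (I : Type) (r : seq I) (c : I -> R) (phi : I -> R -> R) (u : R) :
  u \in `[a, b] -> (forall i, {within `[a, b], continuous (phi i)}) ->
  {within `[a, b], continuous (fun t => \sum_(i <- r) c i * phi i t)} /\
  abel_integral g a al (fun t => \sum_(i <- r) c i * phi i t) u =
  \sum_(i <- r) c i * abel_integral g a al (phi i) u.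
Proof.
move=> uab cphi; elim: r => [|i r [cr IH]].
  have -> : (fun t => \sum_(i <- [::]) c i * phi i t) = cst 0.
    by apply/funext => t; rewrite big_nil.
  split; first exact: cst_continuous.
  by rewrite big_nil abel_integral0.
have -> : (fun t => \sum_(j <- i :: r) c j * phi j t) =
    (fun t => \sum_(j <- r) c j * phi j t - - c i * phi i t).
  by apply/funext => t; rewrite big_cons mulNr opprK addrC.
split; first exact: within_continuousB_scale.
rewrite (abel_integralB_scale dg cg g'_gt0 al01 _ uab cr (cphi i)) IH big_cons.
by rewrite mulNr opprK addrC.
Qed.

Lemma RL_integralMl N phi (u : R) : u \in `[a, b] ->
  (forall A, {within `[a, b], continuous (fun t => coef (phi t) A)}) ->
  RL_integral a al g (fun t => N * phi t) u = N * RL_integral a al g phi u.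
Proof.
move=> uab cphi; apply: cliffordP => C; rewrite coef_RL_integral of_coefK.
under [RHS]eq_bigr do rewrite coef_RL_integral.
pose c A := (-1) ^+ swaps A (symdiff A C) * coef N A.
have -> : (fun t => coef (N * phi t) C) =
    (fun t => \sum_A c A * coef (phi t) (symdiff A C)).
  by apply/funext => t; rewrite of_coefK; apply: eq_bigr => A _; rewrite /c mulrA.
rewrite (abel_integral_sum _ _ uab (fun A => cphi (symdiff A C))).2 mulr_sumr.
by apply: eq_bigr => A _; rewrite /c; ring.
Qed.

Lemma RL_inversion phi K :
  (forall A, {within `[a, b], continuous (fun t => coef (phi t) A)}) ->
  Gamma (1 - al) != 0 ->
  (forall u, u \in `[a, b] -> RL_integral a al g phi u = (g u - g a) *: K) ->
  forall t, t \in `[a, b] ->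
    phi t = (Gamma (1 - al) / beta_const al * (g t - g a) `^ al) *: K.
Proof.
move=> cphi G0 phiE t tab; apply: cliffordP => A; rewrite Defs.coefZ.
rewrite (abel_inversion dg cg g'_gt0 al01 ab (k := Gamma (1 - al) * coef K A) (cphi A) _ tab).
  by ring.
move=> u uab; have := congr1 (fun x => coef x A) (phiE u uab).
rewrite coef_RL_integral Defs.coefZ => /(congr1 (fun x => Gamma (1 - al) * x)).
by rewrite mulVKf// => ->; ring.
Qed.

(** On each coordinate this is the mean value theorem for F - g K. Relative
    difference quotients that converge give continuity on the closed segment and
    ordinary derivatives in its interior, which is all that theorem asks for. *)
Lemma derive_seg_integrate F K : C1_seg a b F ->
  (forall u, u \in `[a, b] -> derive_seg a b F u = derive1 g u *: K) ->
  forall u, u \in `[a, b] -> F u = F a + (g u - g a) *: K.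
Proof.
move=> [cvgF _] dF u uab; apply: cliffordP => A; rewrite Defs.coefD Defs.coefZ.
pose f t := coef (F t) A.
have qf x : x \in `[a, b] -> forall e, 0 < e ->
    \forall t \near x, t != x -> t \in `[a, b] ->
    `|derive1 g x * coef K A - (t - x)^-1 * (f t - f x)| < e.
  move=> xab e e0; have := cvgF x xab; rewrite -/(derive_seg a b F x) dF// => cF.
  have H : \forall t \near x, t != x -> t \in `[a, b] ->
      `|coef (derive1 g x *: K) A - coef (diff_quotient F x t) A| < e.
    by have /cvgrPdist_lt/(_ e e0) := cvg_comp _ _ cF (@continuous_coef A _).
  apply: filterS H => t + tx tab => /(_ tx tab).
  by rewrite Defs.coefZ /diff_quotient Defs.coefZ Defs.coefD Defs.coefN.
have cf : {within `[a, b], continuous f}.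
  apply/subspace_continuousP => x xab; apply/cvgrPdist_lt => e e0.
  set L := derive1 g x * coef K A.
  have H : \forall t \near x, t \in `[a, b] -> `|f x - f t| < e.
    have C0 : 0 < `|L| + 1 by rewrite ltr_wpDl.
    near=> t => tab; have [->|tx] := eqVneq t x; first by rewrite subrr normr0.
    have q1 : `|L - (t - x)^-1 * (f t - f x)| < 1.
      by move: tx tab; near: t; exact: qf.
    have tx0 : t - x != 0 by rewrite subr_eq0.
    have -> : f x - f t = - ((t - x)^-1 * (f t - f x)) * (t - x).
      by rewrite mulrC mulrN mulrA divff// mul1r opprB.
    rewrite normrM normrN.
    have qL : `|(t - x)^-1 * (f t - f x)| < `|L| + 1.
      have := ler_distD L 0 ((t - x)^-1 * (f t - f x)); rewrite !sub0r !normrN.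
      by move=> /le_lt_trans; apply; rewrite ltrD2l.
    apply: (@le_lt_trans _ _ ((`|L| + 1) * `|t - x|)).
      by rewrite ler_wpM2r// ltW.
    rewrite mulrC -ltr_pdivlMr//; near: t.
    have e' : 0 < e / (`|L| + 1) by rewrite divr_gt0.
    have /cvgrPdist_lt/(_ _ e') := @cvg_id _ (nbhs x).
    by apply: filterS => t; rewrite distrC.
  exact: H.
have df x : x \in `]a, b[ -> is_derive x 1 f (derive1 g x * coef K A).
  move=> xab; have xab' := subset_itv_oo_cc xab.
  (* In the interior, the quotients relative to [a, b] are the ordinary ones. *)
  have cvgq : h^-1 *: (f (h *: 1 + x) - f x) @[h --> 0^'] --> derive1 g x * coef K A.
    apply/cvgrPdist_lt => e e0.
    have H : \forall t \near x, t != x ->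
        `|derive1 g x * coef K A - (t - x)^-1 * (f t - f x)| < e.
      have itab := near_in_itvoo xab.
      near=> t => tx.
      have tab : t \in `[a, b].
        by apply: subset_itv_oo_cc; near: t.
      by move: tx tab; near: t; exact: qf.
    have s0 : h + x @[h --> (0 : R)] --> x.
      rewrite -{2}(add0r x); apply: cvgD; first exact: cvg_id.
      exact: cvg_cst.
    have H' : \forall h \near (0 : R), h != 0 ->
        `|derive1 g x * coef K A - h^-1 *: (f (h *: 1 + x) - f x)| < e.
      have H2 : \forall h \near (0 : R), h + x != x ->
        `|derive1 g x * coef K A - (h + x - x)^-1 * (f (h + x) - f x)| < e := s0 _ H.
      apply: filterS H2 => h hx h0.
      have := hx; rewrite addrK /GRing.scale/= mulr1; apply.
      by rewrite -subr_eq0 addrK.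
    exact: H'.
  split; first by apply/cvg_ex; exists (derive1 g x * coef K A).
  by apply: cvg_lim => //; exact: norm_hausdorff.
have [->|ua] := eqVneq u a; first by rewrite subrr mul0r addr0.
have au : a < u.
  by move: uab; rewrite in_itv/= lt_neqAle eq_sym ua => /andP[].
have ub : u <= b by rewrite (itvP uab).
pose m t := f t - coef K A * g t.
have dm t : t \in `]a, u[ -> is_derive t 1 m 0.
  move=> tau; have tab : t \in `]a, b[ by apply: subset_itvl tau; rewrite bnd_simp.
  have dgt : is_derive t 1 g (derive1 g t) by rewrite derive1E; exact: derivableP.
  have := is_deriveB (df t tab) (is_deriveZ (coef K A) dgt).
  by rewrite /GRing.scale/= (mulrC (derive1 g t)) subrr.
have cg' : {within `[a, b], continuous g}.
  apply: continuous_subspaceT => x.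
  by apply/differentiable_continuous/derivable1_diffP.
have cm : {within `[a, u], continuous m}.
  have sub' : `[a, u]%classic `<=` `[a, b] by apply: subset_itvl; rewrite bnd_simp.
  exact/(continuous_subspaceW sub')/within_continuousB_scale.
have [c _] := MVT au dm cm; rewrite mul0r /m /f => mE.
by lra.
Unshelve. all: by end_near. Qed.

End ChangeOfVariable.

(** * Imaginary units *)

(** Doubling w * w symmetrises it into anticommutators of generators. *)
Lemma sphere_sqr w : sphere w -> w * w = -1.
Proof.
move=> [x [x1 ->]].
apply: (@scalerI _ _ (2 : R)); first by rewrite pnatr_eq0.
rewrite scaler_nat mulr2n.
have sq : (\sum_(j < n) x j *: gen R j) * (\sum_(j < n) x j *: gen R j) =
    \sum_(i < n) \sum_(j < n) (x i * x j) *: (gen R i * gen R j).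
  rewrite mulr_suml; apply: eq_bigr => i _; rewrite mulr_sumr; apply: eq_bigr => j _.
  by rewrite -scalerAl -scalerAr scalerA.
rewrite sq {2}exchange_big -big_split/=.
transitivity (\sum_(i < n) (x i ^+ 2) *: (-2 : clifford R n)).
  apply: eq_bigr => i _; rewrite -big_split/= (bigD1 i)//= big1.
    by rewrite addr0 -scalerDr gen_anticomm eqxx mulr1.
  move=> j ji; rewrite [x j * _]mulrC -scalerDr gen_anticomm eq_sym (negPf ji).
  by rewrite mulr0 scaler0.
by rewrite -scaler_suml x1 scale1r scaler_nat mulNrn.
Qed.

Lemma sphereN w : sphere w -> sphere (- w).
Proof.
move=> [x [x1 ->]]; exists (fun j => - x j); split.
  by under eq_bigr do rewrite sqrrN.
by rewrite -sumrN; apply: eq_bigr => j _; rewrite scaleNr.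
Qed.

(** The paravector p - q w is invertible, its inverse being a multiple of
    p + q w. *)
Lemma real_eq_imaginary_multiple w K (p q : R) : w * w = -1 -> q != 0 ->
  p *: K = q *: (w * K) -> K = 0.
Proof.
move=> ww q0 pq.
have pw : p *: (w * K) = - (q *: K).
  by rewrite scalerAr pq -scalerAr mulrA ww mulN1r scalerN.
have : (p ^+ 2 + q ^+ 2) *: K = 0.
  by rewrite scalerDl !expr2 -!scalerA pq scalerA mulrC -scalerA pw scalerN addNr.
move/eqP; rewrite scaler_eq0 gt_eqF => [/eqP//|].
by rewrite ltr_wpDl ?sqr_ge0// exprn_even_gt0.
Qed.

End CliffordValuedCalculus.

(** * Slice monogenic functions have one structure constant *)

Section SliceStructure.
Variables (R : realType) (n : nat) (a b c r s al be : R) (g h : R -> R).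
Variable f : clifford R n -> clifford R n.
Hypotheses (ab : a < b) (c0 : 0 < c) (al01 : 0 < al < 1) (be01 : 0 < be < 1).
Hypotheses (rab : r \in `[a, b]) (s0c : s \in `[0, c]).
Hypotheses (dg : forall x : R, derivable g x 1) (cg : continuous (derive1 g)).
Hypotheses (dh : forall x : R, derivable h x 1) (ch : continuous (derive1 h)).
Hypothesis g'_gt0 : forall x, x \in `[a, b] -> 0 < derive1 g x.
Hypothesis h'_gt0 : forall x, x \in `[0, c] -> 0 < derive1 h x.
Hypothesis fSM : RL_slice_monogenic a b c r s al be g h f.

(** K is the common value of both sides of the separated equation
    A' u / g' u = - w * (B' v / h' v), A and B being the integrals along the two
    lines of the slice of w. *)
Definition slice_constant (K w : clifford R n) : Prop :=
  (forall u, u \in `[a, b] ->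
     RL_integral a al g (horizontal s f w) u = (g u - g a) *: K) /\
  (forall v, v \in `[0, c] ->
     RL_integral 0 be h (vertical r f w) v = (h v - h 0) *: (w * K)).

(** Separation of variables: one summand of the defining equation depends only on
    u and the other only on v, so both are constant; integrating them from the
    left endpoints, where the integrals vanish, gives the two formulas. *)
Lemma slice_constant_exists w : sphere w -> exists K, slice_constant K w.
Proof.
move=> w_sphere; have [_ /(_ w w_sphere)[C1H C1V eqn]] := fSM.
have ww := sphere_sqr w_sphere.
have aab : a \in `[a, b] by rewrite in_itv/= lexx ltW.
have z0c : 0 \in `[0, c] by rewrite in_itv/= lexx ltW.
pose K := (derive1 g a)^-1 *: derive_seg a b (RL_integral a al g (horizontal s f w)) a.
pose V v := (derive1 h v)^-1 *: derive_seg 0 c (RL_integral 0 be h (vertical r f w)) v.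
have VE v : v \in `[0, c] -> V v = w * K.
  move=> v0c; have /eqP := eqn a v aab v0c; rewrite -/K -/(V v) addr_eq0 => /eqP ->.
  by rewrite mulrN mulrA ww mulN1r opprK.
exists K; split.
  move=> u uab; have dA x : x \in `[a, b] ->
      derive_seg a b (RL_integral a al g (horizontal s f w)) x = derive1 g x *: K.
    move=> xab; have := eqn x 0 xab z0c; rewrite -/(V 0) VE// mulrA ww mulN1r.
    move/eqP; rewrite subr_eq0 => /eqP <-.
    by rewrite scalerA divff ?scale1r// gt_eqF// g'_gt0.
  by rewrite (derive_seg_integrate dg C1H dA uab) RL_integral_left add0r.
move=> v v0c; have dB x : x \in `[0, c] ->
    derive_seg 0 c (RL_integral 0 be h (vertical r f w)) x = derive1 h x *: (w * K).
  move=> x0c; rewrite -(VE x x0c) scalerA divff ?scale1r//.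
  by rewrite gt_eqF// h'_gt0.
by rewrite (derive_seg_integrate dh C1V dB v0c) RL_integral_left add0r.
Qed.

Lemma gap_neq0 : g b - g a != 0.
Proof.
rewrite gt_eqF// subr_gt0 (derive1_gt0_lt dg g'_gt0)//.
  by rewrite in_itv/= lexx ltW.
by rewrite in_itv/= lexx ltW.
Qed.

(** Abel inversion makes f a real multiple of K on the horizontal line and a real
    multiple of w * K on the vertical one. The lines meet at r + w s, where the
    second multiple is nonzero because s > 0; this forces K = 0. *)
Lemma slice_constant_eq0 K w : sphere w -> slice_constant K w -> 0 < s -> K = 0.
Proof.
move=> w_sphere [HK VK] s0.
have [[_ /(_ w w_sphere)[acH acV]] _] := fSM.
have bab : b \in `[a, b] by rewrite in_itv/= lexx ltW.
(* A vanishing normalising factor makes the integral, hence K, zero. *)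
have [G0|G0] := eqVneq (Gamma (1 - al)) 0.
  have := HK b bab; rewrite /RL_integral G0 invr0 scale0r => /esym/eqP.
  by rewrite scaler_eq0 (negPf gap_neq0) => /eqP.
have lt0s : h 0 < h s.
  apply: (derive1_gt0_lt dh h'_gt0) => //; first by rewrite in_itv/= lexx ltW.
have ww := sphere_sqr w_sphere.
have [G1|G1] := eqVneq (Gamma (1 - be)) 0.
  have := VK s s0c; rewrite /RL_integral G1 invr0 scale0r => /esym/eqP.
  rewrite scaler_eq0 subr_eq0 gt_eqF//= => /eqP wK.
  by rewrite -[K]mul1r -[1]opprK -ww mulNr -mulrA wK mulr0 oppr0.
have Hr := RL_inversion dg cg g'_gt0 al01 ab
  (fun A => @abs_continuous_coef _ _ _ _ _ A acH) G0 HK rab.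
have Vs := RL_inversion dh ch h'_gt0 be01 c0
  (fun A => @abs_continuous_coef _ _ _ _ _ A acV) G1 VK s0c.
apply: (real_eq_imaginary_multiple ww _ (etrans (esym Hr) Vs)).
rewrite !mulf_neq0 ?invr_eq0 ?(beta_const_neq0 dh ch h'_gt0 be01 c0)//.
by rewrite gt_eqF// powR_gt0// subr_gt0.
Qed.

(** For s = 0 the horizontal line is the real axis in every slice, so all slices
    share one integral and one constant; for s > 0 every constant is 0. *)
Lemma slice_constant_common : exists K, forall w, sphere w -> slice_constant K w.
Proof.
have [[w0 w0_sphere]|nosphere] := pselect (exists w : clifford R n, sphere w); last first.
  by exists 0 => w ws; case: nosphere; exists w.
have [K KP] := slice_constant_exists w0_sphere.
exists K => w w_sphere; have [K' K'P] := slice_constant_exists w_sphere.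
suff -> : K = K' by [].
have [s0|s0] := eqVneq s 0; last first.
  have s_gt0 : 0 < s by move: s0c; rewrite in_itv/= lt_neqAle eq_sym s0 => /andP[].
  by rewrite (slice_constant_eq0 w0_sphere KP)// (slice_constant_eq0 w_sphere K'P).
have bab : b \in `[a, b] by rewrite in_itv/= lexx ltW.
have horizontalE : horizontal s f w0 = horizontal s f w.
  by apply/funext => t; rewrite /horizontal /paravec s0 !scale0r.
by apply: (scalerI gap_neq0); rewrite -(KP.1 b bab) -(K'P.1 b bab) horizontalE.
Qed.

End SliceStructure.

(** * The representation formula *)

Theorem proposition10 (R : realType) (n : nat)
  (a b c alpha beta r s lambda : R) (g h : R -> R)
  (f : clifford R n -> clifford R n)
  (hab : a < b) (hc : 0 < c)
  (halpha : 0 < alpha < 1) (hbeta : 0 < beta < 1)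
  (hr : r \in `[a, b]) (hs : s \in `[0, c])
  (gC2 : C2_on_line g) (hC2 : C2_on_line h)
  (gODE : forall x : R, derive1 (derive1 g) x + 2 * lambda * derive1 g x = 0)
  (hODE : forall x : R, derive1 (derive1 h) x + 2 * lambda * derive1 h x = 0)
  (g'_gt0 : forall u : R, u \in `[a, b] -> 0 < derive1 g u)
  (h'_gt0 : forall v : R, v \in `[0, c] -> 0 < derive1 h v)
  (hf : RL_slice_monogenic a b c r s alpha beta g h f) :
  forall (u v : R) (Ix I : clifford R n),
    u \in `[a, b] -> v \in `[0, c] -> sphere Ix -> sphere I ->
    (derive1 g u)^-1 *: RL_integral a alpha g (horizontal s f Ix) u
    + (derive1 h v)^-1 *: RL_integral 0 beta h (vertical r f Ix) v
    = (2 * derive1 g u)^-1 *: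
        (RL_integral a alpha g
           (fun t => horizontal s f I t - Ix * I * horizontal s f I t) u
         + RL_integral a alpha g
           (fun t => horizontal s f (- I) t
                     + Ix * I * horizontal s f (- I) t) u)
    + (2 * derive1 h v)^-1 *:
        (RL_integral 0 beta h
           (fun t => vertical r f I t - Ix * I * vertical r f I t) v
         + RL_integral 0 beta h
           (fun t => vertical r f (- I) t
                     + Ix * I * vertical r f (- I) t) v).
Proof.
case: gC2 hC2 => dg ddg _ [dh ddh _].
have cg : continuous (derive1 g).
  by move=> x; apply/differentiable_continuous/derivable1_diffP.
have ch : continuous (derive1 h).
  by move=> x; apply/differentiable_continuous/derivable1_diffP.
have [K KP] := slice_constant_common hab hc halpha hbeta hr hs dg cg dh ch
  g'_gt0 h'_gt0 hf.
move=> u v Ix I uab v0c Ix_sphere I_sphere.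
have NI_sphere := sphereN I_sphere.
have [AIx BIx] := KP _ Ix_sphere.
have [AI BI] := KP _ I_sphere.
have [ANI BNI] := KP _ NI_sphere.
have [[_ ac] _] := hf.
have [acHI acVI] := ac _ I_sphere.
have [acHN acVN] := ac _ NI_sphere.
set M := Ix * I.
have subM (phi : R -> clifford R n) :
    (fun t => phi t - M * phi t) = (fun t => (1 - M) * phi t).
  by apply/funext => t; rewrite mulrBl mul1r.
have addM (phi : R -> clifford R n) :
    (fun t => phi t + M * phi t) = (fun t => (1 + M) * phi t).
  by apply/funext => t; rewrite mulrDl mul1r.
have cH w (H : abs_continuous a b (horizontal s f w)) A := @abs_continuous_coef _ _ _ _ _ A H.
have cV w (H : abs_continuous 0 c (vertical r f w)) A := @abs_continuous_coef _ _ _ _ _ A H.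
(* Left multiplication by 1 - M and 1 + M commutes with integration. *)
rewrite !subM !addM.
rewrite !(RL_integralMl dg cg g'_gt0 halpha _ uab (cH _ _))//.
rewrite !(RL_integralMl dh ch h'_gt0 hbeta _ v0c (cV _ _))//.
rewrite AIx// AI// ANI// BIx// BI// BNI//.
have II := sphere_sqr I_sphere.
rewrite -!scalerAr -!scalerDr !scalerA.
have -> : (1 - M) * K + (1 + M) * K = 2 *: K.
  by rewrite -mulrDl addrACA addNr addr0 mulrDl mul1r scaler_nat mulr2n.
have -> : (1 - M) * (I * K) + (1 + M) * (- I * K) = 2 *: (Ix * K).
  have MI : M * (I * K) = - (Ix * K).
    by rewrite /M -mulrA [I * (I * K)]mulrA II mulN1r mulrN.
  rewrite mulNr mulrN !mulrDl mulNr !mul1r MI opprK opprD opprK addrACA subrr add0r.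
  by rewrite scaler_nat mulr2n.
by rewrite !scalerA !invfM; congr (_ *: _ + _ *: _); field; rewrite ?gt_eqF ?g'_gt0 ?h'_gt0.
Qed.
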